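(* Let $(a_j)_{j\ge1}$ be nonnegative integers, $(b(j))_{j\ge1}$ nonnegative integers and $(c(j))_{j\ge1}$ positive integers such that for every $t$ only finitely many $j$ satisfy $c(j)=t$. Define polynomials $F_n(z)$ by \[ \sum_{n\ge 0} F_n(z)q^n=\prod_{j=1}^{\infty}\frac{1}{(1-z^{b(j)}q^{c(j)})^{a_j}} . \] Suppose $a_1=b(1)=c(1)=1$, and suppose there is an integer $m\ge2$ with $m\, b(j)\le c(j)$ for all $j\ge2$. Then: (a) for all $n$ and all $k>n/m$, $[z^k]F_n(z)=[z^{k+1}]F_{n+1}(z)$; (b) if moreover $c(j)-b(j)>0$ for all $j>1$ and, for each fixed integer $D$, the set of $j$ with $c(j)-b(j)=D$ is finite, then for $\ell\le\lfloor n/m\rfloor$, \[ [z^{n-\ell}]F_n(z)=[z^{\ell}]\prod_{j\ge2}\frac{1}{(1-z^{c(j)-b(j)})^{a_j}} . \]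
   Context: $[z^k]P$ denotes the coefficient of $z^k$ in $P$. *)

(* Defs.v *)
From HB Require Import structures.
From mathcomp Require Import all_boot all_order all_algebra.
From mathcomp Require Import boolp classical_sets cardinality.

Set Implicit Arguments.
Unset Strict Implicit.
Unset Printing Implicit Defensive.

Import Order.TTheory GRing.Theory Num.Theory.

Local Open Scope ring_scope.

(* The ring R[[q]] of formal power series: [Fps u] is the sum of the u n q^n, *)
(* and [f n] is the coefficient of q^n in f.                                  *)
Record fps (R : Type) := Fps { fps_coef :> nat -> R }.

HB.instance Definition _ (R : Type) := gen_eqMixin (fps R).
HB.instance Definition _ (R : Type) := gen_choiceMixin (fps R).

Lemma fpsP (R : Type) (f g : fps R) : (forall n, f n = g n) <-> f = g.
Proof.
by split=> [|-> //]; case: f g => f [g] /= fg; congr Fps; apply/funext.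
Qed.

Section FpsZmodule.
Variable R : zmodType.

Definition fps_zero : fps R := Fps (fun=> 0).
Definition fps_opp (f : fps R) : fps R := Fps (fun n => - f n).
Definition fps_add (f g : fps R) : fps R := Fps (fun n => f n + g n).

Lemma fps_addA : associative fps_add.
Proof. by move=> f g h; apply/fpsP => n /=; rewrite addrA. Qed.
Lemma fps_addC : commutative fps_add.
Proof. by move=> f g; apply/fpsP => n /=; rewrite addrC. Qed.
Lemma fps_add0 : left_id fps_zero fps_add.
Proof. by move=> f; apply/fpsP => n /=; rewrite add0r. Qed.
Lemma fps_addN : left_inverse fps_zero fps_opp fps_add.
Proof. by move=> f; apply/fpsP => n /=; rewrite addNr. Qed.

HB.instance Definition _ :=
  GRing.isZmodule.Build (fps R) fps_addA fps_addC fps_add0 fps_addN.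

Lemma fps_coef0 n : (0 : fps R) n = 0. Proof. by []. Qed.
Lemma fps_coefN (f : fps R) n : (- f) n = - f n. Proof. by []. Qed.
Lemma fps_coefD (f g : fps R) n : (f + g) n = f n + g n. Proof. by []. Qed.
Lemma fps_coefB (f g : fps R) n : (f - g) n = f n - g n. Proof. by []. Qed.

End FpsZmodule.

Section FpsRing.
Variable R : comNzRingType.
Implicit Types f g h : fps R.

Definition fps_one : fps R := Fps (fun n => (n == 0%N)%:R).
Definition fps_mul f g : fps R :=
  Fps (fun n => \sum_(i < n.+1) f i * g (n - i)%N).

Let tr N f : {poly R} := \poly_(i < N) f i.

Let trM N f g n : (n < N)%N -> (tr N f * tr N g)`_n = fps_mul f g n.
Proof.
move=> nN; rewrite coefM /=; apply: eq_bigr => i _; rewrite !coef_poly.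
by rewrite (leq_trans (ltn_ord i) nN) (leq_ltn_trans (leq_subr i n) nN).
Qed.

Lemma fps_mulC : commutative fps_mul.
Proof.
by move=> f g; apply/fpsP => n; rewrite -!(@trM n.+1) // mulrC.
Qed.

Lemma fps_mulA : associative fps_mul.
Proof.
move=> f g h; apply/fpsP => n; pose T := tr n.+1.
transitivity ((T f * (T g * T h))`_n).
  rewrite coefM; apply: eq_bigr => i _; rewrite coef_poly ltn_ord.
  by rewrite (@trM n.+1) // ltnS leq_subr.
rewrite mulrA coefM; apply: eq_bigr => i _.
by rewrite (@trM n.+1) ?ltn_ord // coef_poly ltnS leq_subr.
Qed.

Lemma fps_mul1 : left_id fps_one fps_mul.
Proof.
move=> f; apply/fpsP => n /=; rewrite big_ord_recl /= mul1r subn0 big1 ?addr0//.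
by move=> i _; rewrite mul0r.
Qed.

Lemma fps_mulDl : left_distributive fps_mul (@fps_add R).
Proof.
move=> f g h; apply/fpsP => n /=; rewrite -big_split /=.
by apply: eq_bigr => i _; rewrite mulrDl.
Qed.

Lemma fps_one_neq0 : fps_one != 0.
Proof.
apply/eqP => /(congr1 (fun f : fps R => f 0%N)) /= /eqP.
by rewrite oner_eq0.
Qed.

HB.instance Definition _ := GRing.Zmodule_isComNzRing.Build (fps R)
  fps_mulA fps_mulC fps_mul1 fps_mulDl fps_one_neq0.

Lemma fps_coef1 n : (1 : fps R) n = (n == 0%N)%:R. Proof. by []. Qed.
Lemma fps_coefM f g n : (f * g) n = \sum_(i < n.+1) f i * g (n - i)%N.
Proof. by []. Qed.

Lemma fps_coef_sum I (r : seq I) (P : pred I) (F : I -> fps R) n :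
  (\sum_(i <- r | P i) F i) n = \sum_(i <- r | P i) F i n.
Proof. by elim/big_rec2: _ => // i x f _ <-. Qed.

Lemma fps_coefX_small f k n : f 0%N = 0 -> (n < k)%N -> (f ^+ k) n = 0.
Proof.
move=> f0; elim: k n => // k IHk n nk; rewrite exprS fps_coefM.
rewrite big_ord_recl f0 mul0r add0r big1 // => i _; rewrite IHk ?mulr0 //=.
case: n nk i => [|n] nk i; first by case: i.
by rewrite /bump /= subSS (leq_ltn_trans (leq_subr _ _)).
Qed.

(* the constant series c and the indeterminate q *)
Definition fpsC (c : R) : fps R := Fps (fun n => if n == 0%N then c else 0).
Definition fpsX : fps R := Fps (fun n => (n == 1%N)%:R).

Lemma fps_coefCM c f n : (fpsC c * f) n = c * f n.
Proof.
rewrite fps_coefM big_ord_recl /= subn0 big1 ?addr0 // => i _.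
by rewrite mul0r.
Qed.

Lemma fps_coefXn k n : (fpsX ^+ k) n = (n == k)%:R.
Proof.
elim: k n => [|k IHk] n; first by rewrite expr0.
rewrite exprS fps_coefM big_ord_recl /= mul0r add0r.
case: n => [|n]; first by rewrite big_ord0.
rewrite big_ord_recl /= mul1r /bump /= subSS subn0 IHk eqSS.
by rewrite big1 ?addr0 // => i _; rewrite mul0r.
Qed.

End FpsRing.

Section FpsUnitRing.
Variable R : comUnitRingType.
Implicit Types f g h : fps R.

(* f is invertible iff f 0 is, and then f^-1 is the geometric series of       *)
(* u := 1 - f / f 0 divided by f 0; as u 0 = 0, the powers u ^+ k with k > n  *)
(* do not contribute to the coefficient of index n.                           *)
Definition fps_unit : {pred fps R} := fun f => f 0%N \is a GRing.unit.
Definition fps_inv f : fps R :=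
  if f \in fps_unit then
    let u := 1 - fpsC (f 0%N)^-1 * f in
    Fps (fun n => (f 0%N)^-1 * (\sum_(k < n.+1) u ^+ k) n)
  else f.

Lemma fps_mulV : {in fps_unit, left_inverse 1 fps_inv *%R}.
Proof.
move=> f fU; rewrite /fps_inv fU.
set u := 1 - _; have u0 : u 0%N = 0.
  by rewrite fps_coefB fps_coef1 fps_coefCM mulVr ?subrr.
rewrite mulrC; apply/fpsP => n; pose S := \sum_(k < n.+1) u ^+ k.
transitivity (((1 - u) * S) n); last first.
  rewrite -opprB mulNr -subrX1 opprB fps_coefB.
  by rewrite (@fps_coefX_small R u n.+1 n) // subr0.
rewrite /u subKr -/u -mulrA fps_coefCM !fps_coefM mulr_sumr.
apply: eq_bigr => i _ /=; rewrite mulrCA; congr (_ * (_ * _)).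
rewrite !fps_coef_sum (big_ord_widen n.+1 (fun k => (u ^+ k) (n - i)%N));
  last by rewrite ltnS leq_subr.
rewrite big_mkcond; apply: eq_bigr => k _; case: ifP => // /negbT.
by rewrite -leqNgt => nk; rewrite fps_coefX_small.
Qed.

Lemma fps_unitPl f g : g * f = 1 -> fps_unit f.
Proof.
move=> /(congr1 (fun h : fps R => h 0%N)).
rewrite fps_coefM big_ord_recl big_ord0 addr0 /= => gf.
by rewrite /fps_unit; apply/unitrPr; exists (g 0%N); rewrite mulrC.
Qed.

Lemma fps_inv_out : {in [predC fps_unit], fps_inv =1 id}.
Proof. by move=> f; rewrite inE /= /fps_inv => /negbTE ->. Qed.

HB.instance Definition _ := GRing.ComNzRing_hasMulInverse.Build (fps R)
  fps_mulV fps_unitPl fps_inv_out.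

Lemma fps_unitE f : (f \is a GRing.unit) = (f 0%N \is a GRing.unit).
Proof. by []. Qed.

End FpsUnitRing.

Section FpsProduct.
Variable R : comNzRingType.
Implicit Types (f : fps R) (u : nat -> fps R).

Definition fps_cvg u f : Prop :=
  forall n, exists N, forall M, (N <= M)%N -> u M n = f n.

(* Coefficientwise limit; a coefficient that does not stabilise is set to 0.  *)
Definition fps_lim u : fps R :=
  Fps (fun n => xget 0
    [set x : R | exists N, forall M, (N <= M)%N -> u M n = x]%classic).

(* the product of the u j over all j >= m *)
Definition fps_infprod (m : nat) u : fps R :=
  fps_lim (fun N => \prod_(m <= j < N) u j).

Lemma fps_lim_cvg u f : fps_cvg u f -> fps_lim u = f.
Proof.
move=> uf; apply/fpsP => n /=; apply: xget_unique; first exact: uf.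
move=> y [N uy]; have [N' ux] := uf n.
by rewrite -(uy (maxn N N')) ?leq_maxl // ux ?leq_maxr.
Qed.

Lemma fps_infprod_cvg m u :
  (forall n, exists N, forall j, (N <= j)%N ->
     forall i, (i <= n)%N -> u j i = (1 : fps R) i) ->
  fps_cvg (fun N => \prod_(m <= j < N) u j) (fps_infprod m u).
Proof.
move=> u1; suff [f cf] : exists f, fps_cvg (fun N => \prod_(m <= j < N) u j) f.
  by rewrite /fps_infprod (fps_lim_cvg cf).
suff /choice[f fP] : forall n, exists x, exists N, forall M, (N <= M)%N ->
    (\prod_(m <= j < M) u j) n = x by exists (Fps f).
move=> n; have [N uN] := u1 n; pose N' := maxn m N.
exists ((\prod_(m <= j < N') u j) n), N' => M.
move=> /subnKC <-; elim: (M - N')%N => [|k IHk]; first by rewrite addn0.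
have -> : \prod_(m <= j < N' + k.+1) u j =
    u (N' + k)%N * \prod_(m <= j < N' + k) u j.
  by rewrite addnS big_nat_recr 1?mulrC // (leq_trans (leq_maxl m N)) ?leq_addr.
have NN' : (N <= N' + k)%N by rewrite (leq_trans (leq_maxr m N)) ?leq_addr.
rewrite fps_coefM big_ord_recl (uN _ NN') // fps_coef1 mul1r subn0 IHk.
rewrite [X in _ + X]big1 ?addr0 // => i _.
rewrite (uN _ NN') ?lift0 ?ltn_ord //.
by rewrite fps_coef1 mul0r.
Qed.

End FpsProduct.

(* Convergence of the products of geometric factors whose orders d j tend to  *)
(* infinity with j.                                                           *)
Section FpsGeometricProduct.
Variable R : comUnitRingType.
Implicit Types f g h : fps R.

Let eq1 n f := forall i, (i <= n)%N -> f i = (1 : fps R) i.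

Let eq1M n f g : eq1 n f -> eq1 n g -> eq1 n (f * g).
Proof.
move=> f1 g1 i le_in; rewrite -[1 in RHS]mulr1 !fps_coefM.
apply: eq_bigr => k _; congr (_ * _).
  by apply: f1; case: k => k /= ?; apply: leq_trans le_in.
by apply: g1; rewrite (leq_trans (leq_subr _ _)).
Qed.

Let eq1X n f a : eq1 n f -> eq1 n (f ^+ a).
Proof. by move=> f1; elim: a => [//|a IHa]; rewrite exprS; apply: eq1M. Qed.

Let eq1V n f : eq1 n f -> eq1 n f^-1.
Proof.
move=> f1; have fU : f \is a GRing.unit by rewrite fps_unitE f1 ?unitr1.
move=> i le_in; have -> : f^-1 = 1 + (1 - f) * f^-1.
  by rewrite mulrBl mul1r mulrV // addrC subrK.
rewrite fps_coefD [X in _ + X]big1 ?addr0 // => k _.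
rewrite fps_coefB f1 ?subrr ?mul0r //.
by apply: leq_trans le_in; case: k.
Qed.

Lemma fps_infprod_geom_cvg m (a d : nat -> nat) (v : nat -> R)
    (u := fun j => ((1 - fpsC (v j) * fpsX R ^+ d j) ^+ a j)^-1) :
  (forall t, finite_set [set j | (m <= j)%N /\ d j = t]%classic) ->
  fps_cvg (fun N => \prod_(m <= j < N) u j) (fps_infprod m u).
Proof.
move=> dfin; apply: fps_infprod_cvg => n.
have [N dN] : exists N, forall j, (N <= j)%N -> (m <= j)%N -> (n < d j)%N.
  elim: n => [|n [N dN]]; [have := dfin 0%N | have := dfin n.+1];
    move=> /finite_seqP[s /seteqP[sP _]].
    exists (\max_(x <- s) x).+1 => j js mj; rewrite lt0n; apply/eqP => dj.
    have js' : j \in s := sP j (conj mj dj).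
    by have := @leq_bigmax_seq _ s xpredT id j js' isT; rewrite leqNgt js.
  exists (maxn N (\max_(x <- s) x).+1) => j; rewrite geq_max => /andP[Nj js] mj.
  rewrite ltn_neqAle dN // andbT; apply/eqP => dj.
  have js' : j \in s := sP j (conj mj (esym dj)).
  by have := @leq_bigmax_seq _ s xpredT id j js' isT; rewrite leqNgt js.
exists (maxn N m) => j; rewrite geq_max => /andP[Nj mj].
apply/eq1V/eq1X => i le_in; rewrite fps_coefB fps_coefCM fps_coefXn.
by rewrite ltn_eqF ?mulr0 ?subr0 // (leq_ltn_trans le_in) ?dN.
Qed.

End FpsGeometricProduct.

(* Main.v *)
Require Import Defs.
From HB Require Import structures.
From mathcomp Require Import all_boot all_order all_algebra.
From mathcomp Require Import boolp classical_sets cardinality.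
From mathcomp Require Import zify.

Set Implicit Arguments.
Unset Strict Implicit.
Unset Printing Implicit Defensive.

Import Order.TTheory GRing.Theory Num.Theory.

Local Open Scope ring_scope.

(* Write F = G / (1 - z q), where G is the product over j >= 2.  Then         *)
(* F_(n+1) = z F_n + G_(n+1), and m b(j) <= c(j) makes the degree of G_n at   *)
(* most n / m, which gives (a).  Unfolding the recurrence, [z^(n-l)] F_n is   *)
(* the sum over i of [z^i] G_(l+i), cut off at i <= n - l; the terms vanish   *)
(* for i > l, so the cutoff is harmless.  The full sum is the coefficient of  *)
(* z^l in G(1/z, z), and this substitution is multiplicative and maps         *)
(* 1 - z^b q^c to 1 - z^(c - b), which gives (b).                             *)

(** Monomials z^k q^i with [m * k <= i] are closed under multiplication, so [slope m] passes from
    the binomials to [G] through products, inverses ([slopeV]) and limits ([slope_cvg]). With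
    [geom_recurrence] this bound gives (a). For (b), [geom_coef] turns a coefficient of F into a
    diagonal sum of [G]; since [m >= 2], only finitely many terms of that diagonal are nonzero.
    [antidiagM], [antidiagV] and [antidiag_cvg] carry the product formula of [G] over to these
    sums. *)

Section Convergence.
Variable R : comNzRingType.
Implicit Types (f g : fps R) (u : nat -> fps R).

(** A coefficient of a product or of a diagonal sum reads several coefficients, which must stabilise
    from a common rank. *)
Lemma fps_cvg_unif u f : fps_cvg u f ->
  forall n, exists N, forall M, (N <= M)%N ->
    forall i, (i <= n)%N -> u M i = f i.
Proof.
move=> uf; elim=> [|n [N uN]].
  have [N uN] := uf 0%N; exists N => M NM i; rewrite leqn0 => /eqP->.
  exact: uN.
have [N' uN'] := uf n.+1; exists (maxn N N') => M.
rewrite geq_max => /andP[NM N'M] i; rewrite leq_eqVlt => /predU1P[->|].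
  exact: uN'.
by rewrite ltnS; apply: uN.
Qed.

Lemma fps_cvgMl g u f : fps_cvg u f -> fps_cvg (fun N => g * u N) (g * f).
Proof.
move=> uf n; have [N uN] := fps_cvg_unif uf n; exists N => M NM.
rewrite !fps_coefM; apply: eq_bigr => i _; congr (_ * _).
by rewrite uN // leq_subr.
Qed.

Lemma fps_infprod_recl m u :
  fps_cvg (fun N => \prod_(m.+1 <= j < N) u j) (fps_infprod m.+1 u) ->
  fps_infprod m u = u m * fps_infprod m.+1 u.
Proof.
move=> cu; apply: fps_lim_cvg => n.
have [N uN] := fps_cvgMl (u m) cu n; exists (maxn N m.+1) => M.
by rewrite geq_max => /andP[NM mM]; rewrite big_ltn // uN.
Qed.

End Convergence.

(** * Degree bound in z, relative to the power of q *)

Section Slope.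
Variable m : nat.

(* The degree of the coefficient of q^i is at most i / m.                     *)
Definition slope (R : nzRingType) (f : fps {poly R}) : Prop :=
  forall i k, (i < m * k)%N -> (f i)`_k = 0.

Variable R : idomainType.
Implicit Types f g : fps {poly R}.

Lemma slope1 : slope (1 : fps {poly R}).
Proof.
move=> i [|k]; first by rewrite muln0.
by move=> _; rewrite fps_coef1; case: (i == _); rewrite ?coef0 ?coef1.
Qed.

Lemma slopeM f g : slope f -> slope g -> slope (f * g).
Proof.
move=> fs gs i k ik; rewrite fps_coefM coef_sum big1 // => p _.
rewrite coefM big1 // => s _.
have [ps|sp] := ltnP p (m * s)%N; first by rewrite fs ?mul0r.
by rewrite gs ?mulr0 // mulnBr; have := ltn_ord p; lia.
Qed.

Lemma slopeX f n : slope f -> slope (f ^+ n).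
Proof.
by move=> fs; elim: n => [|n IHn]; [exact: slope1|rewrite exprS; apply: slopeM].
Qed.

(** As [f 0 = 1], each coefficient of the inverse is a combination of earlier ones, so strong
    induction applies. *)
Lemma slopeV f : f 0%N = 1 -> slope f -> slope f^-1.
Proof.
move=> f0 fs; have fU : f \is a GRing.unit by rewrite fps_unitE f0 unitr1.
have rec n : (f^-1) n = (1 : fps {poly R}) n -
    \sum_(i < n) f i.+1 * (f^-1) (n - i.+1)%N.
  rewrite -(mulrV fU) fps_coefM big_ord_recl f0 mul1r subn0 /=.
  by rewrite addrK.
move=> i; have [n] := ubnP i; elim: n i => // n IHn i le_in k ik.
rewrite rec coefB slope1 // sub0r coef_sum big1 ?oppr0 // => p _.
rewrite coefM big1 // => s _.
have [ps|sp] := ltnP p.+1 (m * s)%N; first by rewrite fs ?mul0r.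
have ip : (i - p.+1 < i)%N by rewrite subnSK // leq_subr.
rewrite IHn ?mulr0 //; first exact: leq_trans ip le_in.
by rewrite mulnBr; have := ltn_ord p; lia.
Qed.

Lemma slope_cvg u f : (forall N, slope (u N)) -> fps_cvg u f -> slope f.
Proof.
by move=> us uf i k ik; have [N uN] := uf i; rewrite -(uN N) // us.
Qed.

Lemma slope_prod I (r : seq I) (P : pred I) (u : I -> fps {poly R}) :
  (forall j, P j -> slope (u j)) -> slope (\prod_(j <- r | P j) u j).
Proof.
by move=> us; elim/big_ind: _ => //; [exact: slope1|exact: slopeM].
Qed.

Lemma slope_binomial b c : (m * b <= c)%N ->
  slope (1 - fpsC ('X^b) * fpsX {poly R} ^+ c).
Proof.
move=> bc i k ik; rewrite fps_coefB coefB slope1 // sub0r fps_coefCM.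
rewrite fps_coefXn; have [ic|] := eqVneq; last by rewrite mulr0 coef0 oppr0.
rewrite mulr1 coefXn; have [kb|] := eqVneq k b; last by rewrite oppr0.
by move: ik; rewrite ic kb ltnNge bc.
Qed.

End Slope.

Lemma slopeW m m' (R : nzRingType) (f : fps {poly R}) :
  (m <= m')%N -> slope m' f -> slope m f.
Proof.
by move=> mm fs i k ik; apply: fs; rewrite (leq_trans ik) // leq_mul2r mm orbT.
Qed.

Lemma binomial_coef0 (R : comNzRingType) (v : R) c :
  (0 < c)%N -> (1 - fpsC v * fpsX R ^+ c) 0%N = 1.
Proof.
by case: c => // c _; rewrite fps_coefB fps_coefCM fps_coefXn mulr0 subr0.
Qed.

Lemma fps_coef0X (R : comNzRingType) (f : fps R) n :
  f 0%N = 1 -> (f ^+ n) 0%N = 1.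
Proof.
move=> f0; elim: n => // n IHn.
by rewrite exprS fps_coefM big_ord1 f0 IHn mulr1.
Qed.

(** * The substitution f(1/q, q) as a multiplicative map *)

Section Antidiagonal.
Variable R : idomainType.
Implicit Types f g : fps {poly R}.

(* The substitution f(z, q) -> f(z / q, q), provided slope 2 f: this makes    *)
(* the terms omitted by the truncation s <= u vanish.                         *)
Definition shear f : fps {poly R} :=
  Fps (fun u => \poly_(s < u.+1) (f (u + s)%N)`_s).

(* The substitution f(z, q) -> f(1 / q, q). *)
Definition antidiag f : fps R := Fps (fun u => (shear f u).[1]).

Lemma antidiagE f u : antidiag f u = \sum_(s < u.+1) (f (u + s)%N)`_s.
Proof.
by rewrite /= horner_poly; apply: eq_bigr => s _; rewrite expr1n mulr1.
Qed.

Lemma coef_shear f u s : slope 2 f -> (shear f u)`_s = (f (u + s)%N)`_s.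
Proof.
move=> fs; rewrite coef_poly ltnS; case: leqP => // us.
by rewrite fs // mul2n -addnn ltn_add2r.
Qed.

Lemma shearM f g : slope 2 f -> slope 2 g -> shear (f * g) = shear f * shear g.
Proof.
move=> fs gs; apply/fpsP => u; apply/polyP => s.
rewrite coef_shear; last exact: slopeM.
rewrite !fps_coefM !coef_sum.
under eq_bigr do rewrite coefM.
under [RHS]eq_bigr do rewrite coefM.
rewrite exchange_big [RHS]exchange_big /=; apply: eq_bigr => -[p /=].
rewrite ltnS => ps _.
under [RHS]eq_bigr do rewrite !coef_shear //.
(* For fixed [p] only p <= i <= p + u matters: below, the slope of [f] kills the term, above, that
   of [g]. Then put i = p + v. *)
pose X i := (f i)`_p * (g (u + s - i)%N)`_(s - p).
transitivity (\sum_(0 <= i < (u + s).+1) X i); first by rewrite big_mkord.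
have pus : (p <= (u + s).+1)%N by lia.
rewrite (big_cat_nat (leq0n p) pus) //= big_nat_cond big1 ?add0r; last first.
  by move=> i /andP[/andP[_ ip] _]; rewrite /X fs ?mul0r //; lia.
rewrite -{1}[p]add0n big_addn.
have uus : (u.+1 <= (u + s).+1 - p)%N by lia.
rewrite (big_cat_nat (leq0n u.+1) uus) //= [X in _ + X]big_nat_cond.
rewrite [X in _ + X]big1 ?addr0.
  rewrite big_mkord; apply: eq_bigr => -[v /=]; rewrite ltnS => vu _.
  by rewrite /X; congr ((f _)`_ _ * (g _)`_ _); lia.
move=> i /andP[/andP[ui iu] _]; rewrite /X.
by rewrite [(g _)`__]gs ?mulr0 //; lia.
Qed.

Lemma antidiagM f g : slope 2 f -> slope 2 g ->
  antidiag (f * g) = antidiag f * antidiag g.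
Proof.
move=> fs gs; apply/fpsP => u; rewrite -[LHS]/(shear (f * g) u).[1] shearM //.
rewrite !fps_coefM horner_sum.
by apply: eq_bigr => i _; rewrite hornerM.
Qed.

Lemma antidiag1 : antidiag 1 = 1.
Proof.
apply/fpsP => u; rewrite antidiagE big_ord_recl big1 => [|i _]; last first.
  by rewrite fps_coef1 addnS coef0.
by rewrite addn0 addr0 !fps_coef1; case: (u == _); rewrite ?coef0 ?coef1.
Qed.

Lemma antidiagX f n : slope 2 f -> antidiag (f ^+ n) = antidiag f ^+ n.
Proof.
move=> fs; elim: n => [|n IHn]; first by rewrite !expr0 antidiag1.
by rewrite !exprS antidiagM ?IHn //; apply: slopeX.
Qed.

Lemma antidiagV f : f 0%N = 1 -> slope 2 f -> antidiag f^-1 = (antidiag f)^-1.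
Proof.
move=> f0 fs; have fU : f \is a GRing.unit by rewrite fps_unitE f0 unitr1.
have Vf : antidiag f^-1 * antidiag f = 1.
  by rewrite -antidiagM ?mulVr ?antidiag1 //; apply: slopeV.
have afU : antidiag f \is a GRing.unit.
  by apply/unitrPr; exists (antidiag f^-1); rewrite mulrC.
by rewrite -[LHS](mulrK afU) Vf mul1r.
Qed.

Lemma antidiag_prod I (r : seq I) (P : pred I) (u : I -> fps {poly R}) :
  (forall j, P j -> slope 2 (u j)) ->
  antidiag (\prod_(j <- r | P j) u j) = \prod_(j <- r | P j) antidiag (u j).
Proof.
move=> us; elim: r => [|j r IHr]; first by rewrite !big_nil antidiag1.
rewrite !big_cons; case: ifP => // Pj; rewrite antidiagM ?IHr //.
  exact: us.
exact: slope_prod.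
Qed.

Lemma antidiag_cvg u f : fps_cvg u f ->
  fps_cvg (fun N => antidiag (u N)) (antidiag f).
Proof.
(* The diagonal sum of index [n] reads [f] up to index 2n. *)
move=> uf n; have [N uN] := fps_cvg_unif uf (n + n).
exists N => M NM; rewrite !antidiagE; apply: eq_bigr => i _.
by rewrite uN // leq_add2l -ltnS.
Qed.

Lemma antidiag_binomial b c : (2 * b <= c)%N ->
  antidiag (1 - fpsC ('X^b) * fpsX {poly R} ^+ c) = 1 - fpsX R ^+ (c - b).
Proof.
move=> bc; apply/fpsP => u; rewrite antidiagE.
under eq_bigr do rewrite fps_coefB coefB fps_coefCM fps_coefXn.
rewrite sumrB -antidiagE antidiag1 [RHS]fps_coefB; congr (_ - _).
rewrite fps_coefXn; have [->|ucb] := eqVneq u (c - b)%N.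
  (* The term s = b survives the cutoff s <= c - b exactly because 2b <= c. *)
  have bcb : (b < (c - b).+1)%N by lia.
  rewrite (bigD1 (Ordinal bcb)) //= subnK ?eqxx; last by lia.
  rewrite mulr1 coefXn eqxx big1 ?addr0 // => i /eqP ib.
  rewrite mulr_natr coefMn coefXn; case: eqP => [ii|_]; last by rewrite mul0rn.
  by case: ib; apply: val_inj.
rewrite big1 // => i _; have [uic|_] := eqVneq (u + i)%N c; last first.
  by rewrite mulr0 coef0.
rewrite mulr1 coefXn; have [ib|//] := eqVneq (nat_of_ord i) b.
by move: ucb; rewrite -uic ib addnK eqxx.
Qed.

End Antidiagonal.

(** * Effect of the factor 1 / (1 - zq) *)

Lemma geom_recurrence (R : idomainType) (F G : fps {poly R}) :
  F = (1 - fpsC 'X * fpsX {poly R})^-1 * G ->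
  F 0%N = G 0%N /\ forall n, F n.+1 = 'X * F n + G n.+1.
Proof.
set d := 1 - _ => FG; have dU : d \is a GRing.unit.
  by rewrite fps_unitE /d -[fpsX _]expr1 binomial_coef0 // unitr1.
have FE : F = fpsC 'X * (fpsX {poly R} * F) + G.
  have -> : G = d * F by rewrite FG mulVKr.
  by rewrite /d mulrBl mul1r mulrA addrC subrK.
split=> [|n]; rewrite {1}FE fps_coefD fps_coefCM fps_coefM big_ord_recl mul0r.
  by rewrite big_ord0 addr0 mulr0 add0r.
congr (_ * _ + _); rewrite add0r big_ord_recl mul1r subSS subn0.
by rewrite big1 ?addr0 // => i _; rewrite mul0r.
Qed.

(** The recurrence raises the powers of q and z together, so [l] stays fixed and each step adds one
    term of [G]. *)
Lemma geom_coef (R : idomainType) (F G : fps {poly R}) :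
  F = (1 - fpsC 'X * fpsX {poly R})^-1 * G ->
  forall l k, (F (l + k)%N)`_k = \sum_(i < k.+1) (G (l + i)%N)`_i.
Proof.
move=> /geom_recurrence[F0 FS] l; elim=> [|k IHk].
  rewrite big_ord1 addn0; case: l => [|l]; first by rewrite F0.
  by rewrite FS coefD coefXM add0r.
by rewrite big_ord_recr /= -IHk addnS FS coefD coefXM.
Qed.

(** * Both claims from the degree bound on [G] *)

Theorem theorem1 (a b c : nat -> nat) (F : nat -> {poly int}) (m : nat)
  (c_gt0 : forall j, (1 <= j)%N -> (0 < c j)%N)
  (c_fin : forall t : nat,
     finite_set [set j : nat | (1 <= j)%N /\ c j = t]%classic)
  (defF : Fps F = fps_infprod 1 (fun j =>
     ((1 - fpsC ('X^(b j)) * fpsX {poly int} ^+ c j) ^+ a j)^-1))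
  (a1 : a 1%N = 1%N) (b1 : b 1%N = 1%N) (c1 : c 1%N = 1%N)
  (m_ge2 : (2 <= m)%N)
  (mbc : forall j, (2 <= j)%N -> (m * b j <= c j)%N) :
  (forall n k : nat, n%:R / m%:R < k%:R :> rat -> (F n)`_k = (F n.+1)`_k.+1)
  /\
  ((forall j, (1 < j)%N -> 0 < (c j)%:Z - (b j)%:Z) ->
   (forall D : int,
     finite_set [set j : nat | (1 <= j)%N /\ (c j)%:Z - (b j)%:Z = D]%classic) ->
   forall n l : nat, (l <= n %/ m)%N ->
     (F n)`_(n - l) =
     fps_infprod 2 (fun j => ((1 - fpsX int ^+ (c j - b j)) ^+ a j)^-1) l).
Proof.
pose u j : fps {poly int} :=
  ((1 - fpsC ('X^(b j)) * fpsX {poly int} ^+ c j) ^+ a j)^-1.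
have cvgG : fps_cvg (fun N => \prod_(2 <= j < N) u j) (fps_infprod 2 u).
  apply: fps_infprod_geom_cvg => t; apply: sub_finite_set (c_fin t).
  by move=> j [j2 cj]; split=> //; apply: ltnW.
set G := fps_infprod 2 u in cvgG.
have FG : Fps F = (1 - fpsC 'X * fpsX {poly int})^-1 * G.
  rewrite defF (fps_infprod_recl cvgG) -/G; congr (_ * _).
  by rewrite /u a1 b1 c1 !expr1.
have u_slope j : (2 <= j)%N -> slope m (u j).
  move=> j2; apply: slopeV; last exact/slopeX/slope_binomial/mbc.
  by apply/fps_coef0X/binomial_coef0/c_gt0/ltnW.
have G_slope : slope m G.
  apply: slope_cvg cvgG => N; rewrite big_nat_cond.
  by apply: slope_prod => j /andP[/andP[]] /u_slope.
split=> [n k nk|cb_gt0 cb_fin n l ln].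
  have [_ /(_ n)/= ->] := geom_recurrence FG.
  (* From n < k m follows n + 1 < m (k + 1), so [G] contributes nothing. *)
  rewrite coefD coefXM /= G_slope ?addr0 //.
  move: nk; rewrite ltr_pdivrMr ?ltr0n ?(ltnW m_ge2) // -natrM ltr_nat; lia.
have lmn : (l * m <= n)%N by rewrite -leq_divRL // ltnW.
(* Hence l <= n - l: the diagonal sum for [F n] contains every term of [antidiag G l]. *)
have l2n : (l + l <= n)%N.
  by apply: leq_trans lmn; rewrite addnn -muln2 leq_mul2l m_ge2 orbT.
(* The partial products on the left are the antidiagonals of those of [G], so they converge to
   [antidiag G]. *)
have -> : fps_infprod 2 (fun j => ((1 - fpsX int ^+ (c j - b j)) ^+ a j)^-1) =
    antidiag G.
  apply: fps_lim_cvg => t; have [N uN] := antidiag_cvg cvgG t.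
  exists N => M NM; rewrite -(uN M) // [in RHS]big_nat_cond antidiag_prod.
    rewrite -big_nat_cond; congr (fps_coef _ t).
    rewrite !big_nat; apply: eq_bigr => j /andP[j2 _].
    have bc2 : (2 * b j <= c j)%N.
      by apply: leq_trans (mbc _ j2); rewrite leq_mul2r m_ge2 orbT.
    have bs := slope_binomial int bc2.
    rewrite antidiagV; last exact: slopeX.
      by rewrite antidiagX ?antidiag_binomial.
    by apply/fps_coef0X/binomial_coef0/c_gt0/ltnW.
  by move=> j /andP[/andP[/u_slope us _] _]; apply: slopeW us.
have -> : (F n)`_(n - l) = \sum_(i < (n - l).+1) (G (l + i)%N)`_i.
  by rewrite -(geom_coef FG) /= subnKC //; lia.
rewrite antidiagE.
rewrite [RHS](big_ord_widen (n - l).+1 (fun i => (G (l + i)%N)`_i));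
  last by lia.
(* The extra terms have i > l, so l + i < 2i and the slope bound kills them. *)
rewrite [RHS]big_mkcond; apply: eq_bigr => i _; case: ifP => // /negbT.
by move=> il; rewrite (slopeW m_ge2 G_slope) //; lia.
Qed.
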